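(* Let $S$ be a $\mathrm{Cu}$-semigroup and let $x,y,z\in S$. Then: (1) $\rho(x,n\cdot y)=\frac1n\cdot\rho(x,y)$ and $\rho(n\cdot x,y)=n\cdot\rho(x,y)$ for $n\in\mathbb{Z}_{>0}$. (2) If $x\leq y\leq z$, then $\rho(z,y)\leq\rho(z,x)$ and $\rho(x,z)\leq\rho(y,z)$. (3) $\rho(x+y,z)\geq\max\left(\rho(x,z),\rho(y,z)\right)$ and $\rho(z,x+y)\leq\min\left(\rho(z,x),\rho(z,y)\right)$.
   Context: For elements $x,y$ of a partially ordered set $P$, $x\ll y$ means: for every increasing sequence $(y_n)$ in $P$ with supremum $y$ there is $n_0$ with $x\leq y_{n_0}$. A $\mathrm{Cu}$-semigroup is a positively ordered abelian monoid $S$ (so $0\leq x$ for all $x$ and the order is compatible with addition) such that: (O1) every increasing sequence in $S$ has a supremum; (O2) every $x\in S$ is the supremum of a sequence $x_0\ll x_1\ll x_2\ll\cdots$; (O3) if $x'\ll x$ and $y'\ll y$ then $x'+y'\ll x+y$; (O4) $\sup_n(x_n+y_n)=\sup_n x_n+\sup_n y_n$ for all increasing sequences $(x_n),(y_n)$. A functional on $S$ is a map $\lambda\colon S\to[0,\infty]$ that is additive, order preserving, satisfies $\lambda(0)=0$, and preserves suprema of increasing sequences. $\mathcal{F}(S)$ is the set of functionals on $S$. The rank of $x$ is $\widehat{x}\colon\mathcal{F}(S)\to[0,\infty]$, $\widehat{x}(\lambda)=\lambda(x)$. Rank ratio: $\rho(x,y)=\inf\{r\in(0,\infty):\widehat{x}\leq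 r\cdot\widehat{y}\}$ (pointwise inequality on $\mathcal{F}(S)$), with $\rho(x,y)=\infty$ if there is no such $r$. Convention: $\gamma\cdot\infty=\infty$ for $\gamma\in(0,\infty)$. *)

(* Defs.v *)
From HB Require Import structures.
From mathcomp Require Import all_boot all_order all_algebra.
From mathcomp Require Import all_classical all_reals all_analysis.

Set Implicit Arguments.
Unset Strict Implicit.
Unset Printing Implicit Defensive.

Import Order.TTheory GRing.Theory Num.Theory.

Local Open Scope classical_set_scope.
Local Open Scope ring_scope.

(* Sequential (countable) compact containment. *)
Definition way_below d (P : porderType d) (x y : P) : Prop :=
  forall u : nat -> P, nondecreasing_seq u -> isLub (range u) y ->
    exists n0, (x <= u n0)%O.

Notation "x ≪ y" := (way_below x y) (at level 70, no associativity).

(* A commutative monoid together with a partial order, without compatibility.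
   This is a plain record because HB.structure cannot join Nmodule and POrder
   below the existing Num.POrderedZmodule; the HB.instance commands equip the
   carrier with both structures, over the same choiceType.  The order lives at
   ring_display, so that [<=] is available in ring_scope. *)
Record porderedMonoid := POrderedMonoid {
  porderedMonoid_nmod : nmodType;
  porderedMonoid_order : Order.Le_isPOrder ring_display porderedMonoid_nmod
}.

Definition porderedMonoid_sort (S : porderedMonoid) : Type :=
  porderedMonoid_nmod S.
Coercion porderedMonoid_sort : porderedMonoid >-> Sortclass.

HB.instance Definition _ (S : porderedMonoid) :=
  GRing.Nmodule.copy (porderedMonoid_sort S) (porderedMonoid_nmod S).
HB.instance Definition _ (S : porderedMonoid) :
    Order.Le_isPOrder ring_display (porderedMonoid_sort S) :=
  porderedMonoid_order S.

Record is_positively_ordered (S : porderedMonoid) : Prop := {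
  posord_ge0 : forall x : S, (0 : S) <= x;
  posord_leD2r : forall z x y : S, x <= y -> x + z <= y + z
}.

Record cuSemigroup := CuSemigroup {
  cu_monoid :> porderedMonoid;
  cu_posord : is_positively_ordered cu_monoid;
  cu_O1 : forall u : nat -> cu_monoid, nondecreasing_seq u ->
    exists s, isLub (range u) s;
  cu_O2 : forall x : cu_monoid, exists u : nat -> cu_monoid,
    (forall n, u n ≪ u n.+1) /\ isLub (range u) x;
  cu_O3 : forall x' x y' y : cu_monoid,
    x' ≪ x -> y' ≪ y -> x' + y' ≪ x + y;
  cu_O4 : forall (u v : nat -> cu_monoid) (a b : cu_monoid),
    nondecreasing_seq u -> nondecreasing_seq v ->
    isLub (range u) a -> isLub (range v) b ->
    isLub (range (fun n => u n + v n)) (a + b)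
}.

Record functional (R : realType) (S : cuSemigroup) := Functional {
  functional_fun :> S -> \bar R;
  functional_ge0 : forall x, (0 <= functional_fun x)%E;
  functional0 : functional_fun 0 = 0%E;
  functionalD : forall x y,
    functional_fun (x + y) = (functional_fun x + functional_fun y)%E;
  functional_le : forall x y, x <= y ->
    (functional_fun x <= functional_fun y)%E;
  functional_sup : forall (u : nat -> S) (s : S),
    nondecreasing_seq u -> isLub (range u) s ->
    functional_fun s = ereal_sup (range (fun n => functional_fun (u n)))
}.

Definition rank (R : realType) (S : cuSemigroup) (x : S) :
    functional R S -> \bar R :=
  fun l => l x.

(* [ereal_inf set0 = +oo], which covers the case where no r is admissible. *)
Definition rank_ratio (R : realType) (S : cuSemigroup) (x y : S) : \bar R :=
  ereal_inf [set r%:E | r in [set r : R | 0 < r /\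
    forall l : functional R S, (rank x l <= r%:E * rank y l)%E]].

Arguments rank_ratio R {S} x y.

(* Main.v *)
Require Import Defs.
From mathcomp Require Import all_boot all_order all_algebra.
From mathcomp Require Import all_classical all_reals all_analysis.

Set Implicit Arguments.
Unset Strict Implicit.
Unset Printing Implicit Defensive.

Import Order.TTheory GRing.Theory Num.Theory.

Local Open Scope ring_scope.

Local Open Scope ereal_scope.

(** Everything reduces to comparing the sets of admissible constants [r]. If multiplication by some
    [c > 0] carries admissible constants for one pair to admissible constants for another, the
    infima compare up to the factor [c] ([rank_ratio_le_scale]); if it does so in both directions,
    they are equal up to [c] ([rank_ratio_scale]). Since ranks are additive, (1) is the two-sided
    case with [c = 1/n] or [c = n]. Since ranks are monotone, (2) is the one-sided case with
    [c = 1], and (3) follows because positivity puts both summands below [x + y]. *)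

Definition rank_dominated (R : realType) (S : cuSemigroup) (x y : S) (r : R) :
    Prop :=
  forall l : functional R S, rank x l <= r%:E * rank y l.

Lemma rankMn (R : realType) (S : cuSemigroup) (x : S) (n : nat)
    (l : functional R S) : rank (x *+ n)%R l = n%:R%:E * rank x l.
Proof.
rewrite /rank; elim: n => [|n IHn]; first by rewrite mulr0n functional0 mul0e.
rewrite mulrSr functionalD IHn -natr1 EFinD.
(* Both scalars [n] and [1] are nonnegative, so distributivity survives an infinite rank. *)
by rewrite ge0_muleDl ?lee_fin // mul1e.
Qed.

(** Dividing by [c] first leaves a lower bound to check on each admissible [r]; if there is none,
    the right-hand infimum is infinite and the check is vacuous. *)
Lemma rank_ratio_le_scale (R : realType) (S : cuSemigroup) (x y x' y' : S)
    (c : R) : (0 < c)%R ->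
  (forall r, (0 < r)%R -> rank_dominated x y r ->
     rank_dominated x' y' (c * r)%R) ->
  rank_ratio R x' y' <= c%:E * rank_ratio R x y.
Proof.
move=> c0 xy; rewrite -lee_pdivrMl //; apply/ereal_infP => _ [r [r0 xyr] <-].
rewrite lee_pdivrMl // -EFinM; apply: ereal_inf_lbound.
by exists (c * r)%R => //; split; [exact: mulr_gt0 | exact: xy].
Qed.

Lemma rank_ratio_scale (R : realType) (S : cuSemigroup) (x y x' y' : S)
    (c : R) : (0 < c)%R ->
  (forall r, rank_dominated x y r <-> rank_dominated x' y' (c * r)%R) ->
  rank_ratio R x' y' = c%:E * rank_ratio R x y.
Proof.
move=> c0 xy; apply/eqP; rewrite eq_le; apply/andP; split.
  by apply: rank_ratio_le_scale => // r _ /xy.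
(* The reverse inequality is the one-sided bound with the pairs exchanged and factor [c^-1]. *)
rewrite -lee_pdivlMl //; apply: rank_ratio_le_scale; first by rewrite invr_gt0.
by move=> r _ xyr; apply/xy; rewrite mulVKf ?gt_eqF.
Qed.

Lemma rank_ratio_le (R : realType) (S : cuSemigroup) (x x' y y' : S) :
  (x <= x')%R -> (y' <= y)%R -> rank_ratio R x y <= rank_ratio R x' y'.
Proof.
move=> xx' yy'; rewrite -[leRHS]mul1e.
(* With factor 1, the same [r] works: the rank of [x] is at most that of [x'], hence at most [r]
   times that of [y'], hence at most [r] times that of [y]. *)
apply: rank_ratio_le_scale => // r r0 x'y' l; rewrite mul1r.
apply: le_trans (functional_le l xx') _; apply: le_trans (x'y' l) _.
by rewrite lee_pmul2l // ?lte_fin //; exact: functional_le.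
Qed.

Lemma cu_leDl (S : cuSemigroup) (x y : S) : (x <= x + y)%R.
Proof.
have [ge0 leD] := cu_posord S.
by rewrite addrC -[leLHS]add0r; exact: leD.
Qed.

Local Close Scope ereal_scope.

Theorem lemma4p7 (R : realType) (S : cuSemigroup) (x y z : S) :
  (forall n : nat, (0 < n)%N ->
     rank_ratio R x (y *+ n) = ((1 / n%:R)%:E * rank_ratio R x y)%E /\
     rank_ratio R (x *+ n) y = (n%:R%:E * rank_ratio R x y)%E) /\
  (x <= y -> y <= z ->
     (rank_ratio R z y <= rank_ratio R z x)%E /\
     (rank_ratio R x z <= rank_ratio R y z)%E) /\
  ((Order.max (rank_ratio R x z) (rank_ratio R y z)
      <= rank_ratio R (x + y)%R z)%E /\
   (rank_ratio R z (x + y)%R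
      <= Order.min (rank_ratio R z x) (rank_ratio R z y))%E).
Proof.
split.
  move=> n n0; have nR0 : (0 : R) < n%:R by rewrite ltr0n.
  split; apply: rank_ratio_scale => //; first by rewrite divr_gt0.
    (* The factor [1/n] cancels the [n] coming from the rank of [y *+ n], so both conditions have
       the same right-hand side. *)
    move=> r; suff E (l : functional R S) :
        ((1 / n%:R * r)%:E * rank (y *+ n)%R l = r%:E * rank y l)%E.
      by split=> xy l; move: (xy l); rewrite E.
    by rewrite rankMn muleA -EFinM mul1r mulrAC mulVf ?mul1r // gt_eqF.
  (* Here [n] multiplies both sides; being finite and positive, it cancels even at infinite
     values. *)
  move=> r; suff E (l : functional R S) :
      (rank (x *+ n)%R l <= (n%:R * r)%:E * rank y l)%E
      = (rank x l <= r%:E * rank y l)%E.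
    by split=> xy l; move: (xy l); rewrite E.
  by rewrite rankMn EFinM -muleA lee_pmul2l // lte_fin.
split; first by move=> xy yz; split; apply: rank_ratio_le.
have xD : x <= x + y := cu_leDl x y.
have yD : y <= x + y by rewrite addrC; exact: cu_leDl.
by split; rewrite ?ge_max ?le_min; apply/andP; split; apply: rank_ratio_le.
Qed.
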